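(* Let $\otimes_\alpha$ be a tensor product (of order $l$) of $0$-symmetric convex bodies. If $P_i\subset\mathbb{E}_i$, $i=1,\ldots,l$, are $0$-symmetric convex bodies with enough symmetries, then $P_1\otimes_\alpha\cdots\otimes_\alpha P_l$ has enough symmetries too.
   Context: A Euclidean space is a finite dimensional real inner product space; $\mathbb{E}_i,\mathbb{F}_i$ denote Euclidean spaces. $\otimes_{i=1}^l\mathbb{E}_i$ carries the scalar product determined by $\langle x^1\otimes\cdots\otimes x^l,y^1\otimes\cdots\otimes y^l\rangle_H=\prod_i\langle x^i,y^i\rangle_{\mathbb{E}_i}$. A convex body is a compact convex set with nonempty interior; it is $0$-symmetric if $P=-P$. The polar of $C$ is $C^\circ=\{y:\sup_{x\in C}\langle x,y\rangle\le1\}$ (with respect to $\langle\cdot,\cdot\rangle_H$ in tensor product spaces). For convex bodies $P_i\subset\mathbb{E}_i$ with $0$ in the interior, $P_1\otimes_\pi\cdots\otimes_\pi P_l:=\mathrm{conv}\{x^1\otimes\cdots\otimes x^l:x^i\in P_i\}$ and $P_1\otimes_\epsilon\cdots\otimes_\epsilon P_l:=(P_1^\circ\otimes_\pi\cdots\otimes_\pi P_l^\circ)^\circ$. A tensor product $\otimes_\alpha$ of order $l$ of $0$-symmetric convex bodies assigns to each $l$-tuple of $0$-symmetric convex bodies $P_i\subset\mathbb{E}_i$ a $0$-symmetric convex body $P_1\otimes_\alpha\cdots\otimes_\alpha P_l\subset\otimes_{i=1}^l\mathbb{E}_i$ such that (1) $P_1\otimes_\pi\cdots\otimes_\pi P_l\subseteq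 P_1\otimes_\alpha\cdots\otimes_\alpha P_l\subseteq P_1\otimes_\epsilon\cdots\otimes_\epsilon P_l$; (2) for all linear $T_i:\mathbb{E}_i\to\mathbb{F}_i$ and $0$-symmetric convex bodies $Q_i\subset\mathbb{F}_i$ with $T_i(P_i)\subseteq Q_i$, $T_1\otimes\cdots\otimes T_l(P_1\otimes_\alpha\cdots\otimes_\alpha P_l)\subseteq Q_1\otimes_\alpha\cdots\otimes_\alpha Q_l$. For a $0$-symmetric convex body $P\subset\mathbb{E}$, $Iso(P)$ is the set of linear maps $w:\mathbb{E}\to\mathbb{E}$ with $wP=P$. $P$ has enough symmetries if the only linear maps $T:\mathbb{E}\to\mathbb{E}$ that commute with every $w\in Iso(P)$ are the scalar multiples of the identity. *)

(* Defs.v *)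
From HB Require Import structures.
From mathcomp Require Import all_boot all_order all_algebra.
From mathcomp Require Import sesquilinear.
From mathcomp Require Import all_classical all_reals all_analysis.
From mathcomp Require Import ring lra.

Set Implicit Arguments.
Unset Strict Implicit.
Unset Printing Implicit Defensive.

Import Order.TTheory GRing.Theory Num.Theory.
Import numFieldNormedType.Exports.

Local Open Scope classical_set_scope.
Local Open Scope ring_scope.

(* A finite dimensional real inner product space, with its norm topology: the
   norm of the normed module is the one induced by [inner]. *)
HB.mixin Record isEuclidean (R : realType) E
    of NormedModule R E & Vector R E := {
  inner : {dot E for (@idfun R)} ;
  inner_sqr_norm : forall x : E, inner x x = `|x| ^+ 2
}.

#[short(type="euclideanType")]
HB.structure Definition Euclidean (R : realType) :=
  {E of NormedModule R E & Vector R E & isEuclidean R E}.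

Section dot_norm.
Context {R : realType} {V : lmodType R} (f : {dot V for (@idfun R)}).

Let fC x y : f x y = f y x.
Proof. by rewrite hermC /= expr0 mul1r. Qed.

Let f_ge0 x : 0 <= f x x.
Proof.
have [->|x0] := eqVneq x 0; first by rewrite linear0l.
exact/ltW/neq0_dnorm_gt0.
Qed.

Definition dot_norm x := Num.sqrt (f x x).

Lemma dot_norm_sqr x : f x x = dot_norm x ^+ 2.
Proof. by rewrite sqr_sqrtr. Qed.

Lemma dot_CS x y : f x y <= dot_norm x * dot_norm y.
Proof.
have [->|y0] := eqVneq y 0.
  by rewrite linear0r mulr_ge0 ?sqrtr_ge0.
have yy : 0 < f y y by exact: neq0_dnorm_gt0.
rewrite (le_trans (ler_norm _))// -sqrtr_sqr -sqrtrM//.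
apply: ler_wsqrtr.
have := f_ge0 (f y y *: x - f x y *: y).
rewrite linearBl !linearBr !linearZl_LR !linearZr_LR /= (fC y x).
set a := f x x; set b := f x y; set c := f y y => H.
have : 0 <= c * (a * c - b ^+ 2) by move: H; rewrite /GRing.scale /=; lra.
by rewrite pmulr_rge0// subr_ge0.
Qed.

Lemma dot_normD x y : dot_norm (x + y) <= dot_norm x + dot_norm y.
Proof.
rewrite -(@ler_pXn2r _ 2)// ?nnegrE ?addr_ge0 ?sqrtr_ge0//.
rewrite -dot_norm_sqr linearDl !linearDr /= (fC y x) !dot_norm_sqr.
have := dot_CS x y; nra.
Qed.

Lemma dot_normZ (a : R) x : dot_norm (a *: x) = `|a| * dot_norm x.
Proof.
rewrite /dot_norm linearZl_LR linearZr_LR /= mulrA -expr2 sqrtrM ?sqr_ge0//.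
by rewrite sqrtr_sqr.
Qed.

Lemma dot_norm0_eq0 x : dot_norm x = 0 -> x = 0.
Proof.
move=> x0; apply/eqP/negP => /negP /(@neq0_dnorm_gt0 _ _ _ f).
by rewrite dot_norm_sqr x0 expr0n ltxx.
Qed.

End dot_norm.

Lemma posdef_factor (R : realType) n (G : 'M[R]_n) :
  G^T = G -> (forall x : 'rV_n, x != 0 -> 0 < (x *m G *m x^T) 0 0) ->
  exists2 A : 'M[R]_n, A \in unitmx & G = A *m A^T.
Proof.
elim: n => [|n IH] in G *.
  by move=> _ _; exists 1%:M; [exact: unitmx1|rewrite [LHS]flatmx0 [RHS]flatmx0].
rewrite -[n.+1]/(1 + n)%N in G *.
rewrite -[G]submxK.
set a := ulsubmx G; set b := ursubmx G; set c := dlsubmx G; set d := drsubmx G.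
rewrite tr_block_mx => /eq_block_mx[_ cb bc dd] pos.
have a0 : 0 < a 0 0.
  have := pos (row_mx 1%:M 0).
  rewrite mul_row_block !mul1mx !mul0mx !addr0 tr_row_mx mul_row_col trmx0.
  rewrite mulmx0 addr0 trmx1 mulmx1; apply.
  apply/eqP => /(congr1 (fun M : 'rV_(1 + n) => lsubmx M 0 0)).
  by rewrite row_mxKl !mxE eqxx => /eqP; rewrite oner_eq0.
set r := Num.sqrt (a 0 0).
have r0 : 0 < r by rewrite sqrtr_gt0.
have rr : r * r = a 0 0 by rewrite -expr2 sqr_sqrtr// ltW.
have aE : a = (a 0 0)%:M by rewrite [a in LHS]mx11_scalar.
pose e := r^-1 *: c.
have [||A' A'u dA] := IH (d - e *m e^T).
- by rewrite linearB /= trmx_mul trmxK dd.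
- move=> y y0; pose x := - (a 0 0)^-1 *: (y *m c).
  have := pos (row_mx x y).
  have -> : row_mx x y != 0.
    apply: contra_neq y0 => /(congr1 rsubmx).
    by rewrite row_mxKr linear0.
  move=> /(_ isT); rewrite mul_row_block tr_row_mx mul_row_col.
  have -> : x *m a + y *m c = 0.
    rewrite aE mul_mx_scalar /x scalerA mulrN divff ?gt_eqF//.
    by rewrite scaleN1r addNr.
  rewrite mul0mx add0r mulmxBr mulmxBl.
  rewrite -cb /x -scalemxAl /e linearZ /= -scalemxAr -scalemxAl scalerA.
  rewrite scaleNr -invfM rr addrC mulmxDl mulNmx -scalemxAr -scalemxAl.
  by rewrite -?scalemxAl !mulmxA.
exists (block_mx (r%:M : 'M[R]_1) 0 e A').
  rewrite unitmxE det_lblock det_scalar1 unitrM -unitmxE A'u andbT.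
  by rewrite unitfE gt_eqF.
rewrite tr_block_mx mulmx_block !trmx0 !mul0mx !mulmx0 !addr0 tr_scalar_mx.
rewrite -scalar_mxM rr -dA -aE mul_scalar_mx mul_mx_scalar.
rewrite /e [(_ *: c)^T]linearZ /= !scalerA divff ?gt_eqF// !scale1r.
by rewrite addrC subrK cb.
Qed.

Lemma prod_sum_dffun (R : comNzRingType) (I : finType) (d : I -> nat)
    (F : forall i, 'I_(d i) -> R) :
  \prod_i \sum_j F i j = \sum_(f : {dffun forall i, 'I_(d i)}) \prod_i F i (f i).
Proof.
under eq_bigr => i _ do rewrite (big_tag (fun i j => F i j)).
rewrite (bigA_distr_big_dep (fun i => tagged_with (fun i => 'I_(d i)) i)).
have := @big_fprod R 0 1 *%R +%R I (fun i => 'I_(d i)) (fun i => finfun (F i)).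
rewrite (reindex (@fprod_of_dffun _ _)); last first.
  by apply: onW_bij; exists (@dffun_of_fprod _ _); [exact: fprod_of_dffunK|exact: dffun_of_fprodK].
move=> H.
transitivity (\sum_f \prod_(i in I) finfun (F i) (@fprod_of_dffun I (fun i => 'I_(d i)) f i)); last first.
  by apply: eq_bigr => f _; apply: eq_bigr => i _; rewrite ffunE fprodE.
rewrite H; apply: eq_bigr => g gf; apply: eq_bigr => i _.
by rewrite /untag; case: eqP => // e; rewrite ffunE.
Qed.

Section tensor_space.
Context {R : realType} {l : nat}.
Implicit Type E F : 'I_l -> euclideanType R.

Definition tensor_basis E i (j : 'I_(\dim {:E i})) : E i := (vbasis {:E i})`_j.
Definition tensor_coord E i (j : 'I_(\dim {:E i})) (x : E i) : R :=
  coord (vbasis {:E i}) j x.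

Definition tensor_index E : finType := {dffun forall i, 'I_(\dim {:E i})}.

(* E_0 (x) ... (x) E_(l-1): a tensor is given by its coordinates on the products
   of the vectors of the bases [vbasis {:E i}]. The spaces E i, and not only
   their dimensions, are part of the type: its inner product is not the standard
   one of the coordinates, since [vbasis] need not be orthonormal. *)
Definition tensor E : Type := {ffun tensor_index E -> R}.
HB.instance Definition _ E := Vector.copy (tensor E) {ffun tensor_index E -> R}.

Definition pure_tensor E (x : forall i, E i) : tensor E :=
  [ffun f : tensor_index E => \prod_i tensor_coord (f i) (x i)].

(* The bilinear extension of the product formula from pure tensors of basis
   vectors; see [inner_pure_tensor]. *)
Definition tensor_inner E (s t : tensor E) : R :=
  \sum_f \sum_g
    s f * t g * \prod_i inner (tensor_basis (f i)) (tensor_basis (g i)).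

Lemma tensor_coordE E i (x : E i) :
  x = \sum_(j < \dim {:E i}) tensor_coord j x *: tensor_basis j.
Proof. by rewrite [LHS](coord_vbasis (memvf x)). Qed.

Lemma tensor_coord_inj E i (a : 'I_(\dim {:E i}) -> R) :
  \sum_j a j *: tensor_basis j = 0 -> forall j, a j = 0.
Proof. exact: freeP (basis_free (vbasisP {:E i})) a. Qed.

Lemma tensor_coord_basis E i (j k : 'I_(\dim {:E i})) :
  tensor_coord k (tensor_basis j) = (k == j)%:R.
Proof.
rewrite /tensor_coord /tensor_basis.
by rewrite coord_free ?(basis_free (vbasisP _))// eq_sym.
Qed.

Lemma tensor_index_neq E (f g : tensor_index E) :
  f != g -> exists i, f i != g i.
Proof.
move=> fg; apply/existsP; rewrite -negb_forall; apply: contra fg => /forallP fg.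
by apply/eqP/ffunP => i; exact/eqP/fg.
Qed.

Lemma prod_tensor_coord_basis E (f g : tensor_index E) :
  \prod_i tensor_coord (g i) (tensor_basis (f i)) = (g == f)%:R :> R.
Proof.
under eq_bigr do rewrite tensor_coord_basis.
have [->|gf] := eqVneq g f; first by rewrite big1// => i _; rewrite eqxx.
have [i gfi] := tensor_index_neq gf.
by rewrite (bigD1 i)//= (negbTE gfi) mul0r.
Qed.

Lemma tensor_pureE E (t : tensor E) :
  t = \sum_(f : tensor_index E) t f *: pure_tensor (fun i => tensor_basis (f i)).
Proof.
apply/ffunP => g; rewrite sum_ffunE (bigD1 g)//= big1 => [|f fg].
  by rewrite addr0 !ffunE prod_tensor_coord_basis eqxx [RHS]mulr1.
by rewrite !ffunE prod_tensor_coord_basis eq_sym (negbTE fg) scaler0.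
Qed.

Lemma tensor_inner_pure E (x y : forall i, E i) :
  tensor_inner (pure_tensor x) (pure_tensor y) = \prod_i inner (x i) (y i).
Proof.
transitivity (\prod_i \sum_(j < \dim {:E i}) \sum_(k < \dim {:E i})
    (tensor_coord j (x i) * tensor_coord k (y i) *
     inner (tensor_basis j) (tensor_basis k))); last first.
  apply: eq_bigr => i _.
  rewrite [x i in RHS]tensor_coordE [y i in RHS]tensor_coordE.
  rewrite linear_sumlz; apply: eq_bigr => j _.
  rewrite linear_sumr; apply: eq_bigr => k _.
  rewrite [in RHS]linearZr_LR /= (linearZl_LR (inner : {dot _ for _})) /=.
  by rewrite /GRing.scale /= mulrCA mulrA.
rewrite prod_sum_dffun; apply: eq_bigr => f _.
rewrite prod_sum_dffun; apply: eq_bigr => g _.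
by rewrite !ffunE -!big_split.
Qed.

Lemma tensor_innerDl E (s1 s2 t : tensor E) :
  tensor_inner (s1 + s2) t = tensor_inner s1 t + tensor_inner s2 t.
Proof.
rewrite -big_split; apply: eq_bigr => f _.
by rewrite -big_split; apply: eq_bigr => g _; rewrite ffunE /= !mulrDl.
Qed.

Lemma tensor_innerZl E a (s t : tensor E) :
  tensor_inner (a *: s) t = a * tensor_inner s t.
Proof.
rewrite big_distrr; apply: eq_bigr => f _.
rewrite big_distrr; apply: eq_bigr => g _.
by rewrite ffunE /= !mulrA.
Qed.

Lemma tensor_innerC E (s t : tensor E) : tensor_inner s t = tensor_inner t s.
Proof.
rewrite [LHS]exchange_big; apply: eq_bigr => f _; apply: eq_bigr => g _ /=.
under eq_bigr => i _ do rewrite hermC /= expr0 mul1r.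
by rewrite [s g * _]mulrC.
Qed.

Lemma gram_factor E i :
  exists2 A : 'M[R]_(\dim {:E i}), A \in unitmx &
    forall j k : 'I_(\dim {:E i}),
      inner (tensor_basis j) (tensor_basis k) = \sum_h A j h * A k h.
Proof.
pose G : 'M[R]_(\dim {:E i}) :=
  \matrix_(j, k) inner (tensor_basis j) (tensor_basis k).
have [||A Au GA] := @posdef_factor R _ G.
- by apply/matrixP => j k; rewrite !mxE hermC /= expr0 mul1r.
- move=> x x0; pose v := \sum_j x 0 j *: tensor_basis j : E i.
  have -> : (x *m G *m x^T) 0 0 = inner v v.
    rewrite /v linear_sumr mxE; apply: eq_bigr => k _.
    rewrite (linearZr_LR (inner : {dot _ for _})) /= linear_sumlz !mxE mulrC.
    congr (_ * _).
    by apply: eq_bigr => j _; rewrite (linearZl_LR (inner : {dot _ for _})) mxE.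
  apply: neq0_dnorm_gt0; apply: contra_neq x0 => /tensor_coord_inj x0.
  by apply/rowP => j; rewrite x0 mxE.
exists A => // j k; have /matrixP/(_ j k) := GA.
by rewrite !mxE => ->; apply: eq_bigr => h _; rewrite mxE.
Qed.

Lemma tensor_inner_gt0 E (t : tensor E) : t != 0 -> 0 < tensor_inner t t.
Proof.
move=> t0.
pose A i := s2val (cid2 (gram_factor E i)).
have Au i : A i \in unitmx by rewrite /A; case: cid2.
have AE i (j k : 'I_(\dim {:E i})) :
    inner (tensor_basis j) (tensor_basis k) = \sum_h A i j h * A i k h.
  by rewrite /A; case: cid2.
pose u (h : tensor_index E) := \sum_f t f * \prod_i A i (f i) (h i).
have -> : tensor_inner t t = \sum_h u h ^+ 2.
  under [RHS]eq_bigr => h _ do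
    rewrite expr2 /u big_distrlr /=.
  rewrite [RHS]exchange_big; apply: eq_bigr => f _ /=.
  rewrite [RHS]exchange_big; apply: eq_bigr => g _ /=.
  under eq_bigr => i _ do rewrite AE.
  rewrite prod_sum_dffun big_distrr; apply: eq_bigr => h _ /=.
  by rewrite big_split /=; ring.
rewrite lt0r sumr_ge0 ?andbT => [|h _]; last exact: sqr_ge0.
apply: contra_neq t0 => /eqP.
rewrite psumr_eq0 => [/allP u0|h _]; last exact: sqr_ge0.
have {}u0 h : u h = 0.
  by have := u0 h (mem_index_enum _); rewrite sqrf_eq0 => /eqP.
apply/ffunP => g; rewrite ffunE.
transitivity (\sum_h u h * \prod_i invmx (A i) (h i) (g i)); last first.
  by rewrite big1// => h _; rewrite u0 mul0r.
under eq_bigr => h _ do rewrite big_distrl /=.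
rewrite exchange_big (bigD1 g)//= [X in _ + X]big1 ?addr0 => [|f fg].
- under eq_bigr => h _ do rewrite -mulrA -big_split /=.
  rewrite -big_distrr /=
    -(prod_sum_dffun (fun i j => A i (g i) j * invmx (A i) j (g i))).
  rewrite big1 ?mulr1// => i _.
  by have /matrixP/(_ (g i) (g i)) := mulmxV (Au i); rewrite !mxE eqxx.
- under eq_bigr => h _ do rewrite -mulrA -big_split /=.
  rewrite -big_distrr /=
    -(prod_sum_dffun (fun i j => A i (f i) j * invmx (A i) j (g i))).
  have [i fgi] := tensor_index_neq fg.
  rewrite (bigD1 i)//=.
  have /matrixP/(_ (f i) (g i)) := mulmxV (Au i).
  by rewrite !mxE (negbTE fgi) => ->; rewrite mul0r mulr0.
Qed.

Section tensor_dot.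
Variable E : 'I_l -> euclideanType R.

Let tensor_bilinear : bilinear_for
  (GRing.Scale.Law.clone _ _ *%R _) (GRing.Scale.Law.clone _ _ *%R _)
  (@tensor_inner E).
Proof.
split=> s a x y /=.
- by rewrite tensor_innerDl tensor_innerZl.
- by rewrite ![tensor_inner s _]tensor_innerC tensor_innerDl tensor_innerZl.
Qed.

HB.instance Definition _ :=
  bilinear_isBilinear.Build R _ _ _ _ _ (@tensor_inner E) tensor_bilinear.

Let tensor_hermitian s t :
  tensor_inner s t = (-1) ^+ false * idfun (@tensor_inner E t s).
Proof. by rewrite expr0 mul1r tensor_innerC. Qed.

HB.instance Definition _ :=
  isHermitianSesquilinear.Build R _ false idfun (@tensor_inner E)
    tensor_hermitian.

HB.instance Definition _ :=
  isDotProduct.Build R _ (@tensor_inner E) (@tensor_inner_gt0 E).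

Definition tensor_dot : {dot (tensor E) for (@idfun R)} := @tensor_inner E.

HB.instance Definition _ :=
  Lmodule_isNormed.Build R (tensor E) (dot_normD tensor_dot)
    (dot_normZ tensor_dot) (@dot_norm0_eq0 _ _ tensor_dot).

HB.instance Definition _ :=
  isEuclidean.Build R (tensor E) (dot_norm_sqr tensor_dot).

End tensor_dot.

Lemma inner_pure_tensor E (x y : forall i, E i) :
  inner (pure_tensor x) (pure_tensor y) = \prod_i inner (x i) (y i).
Proof. exact: tensor_inner_pure. Qed.

Section tensor_map.
Variables E F : 'I_l -> euclideanType R.
Variable T : forall i, 'Hom(E i, F i).

(* The linear extension of the values on pure tensors of basis vectors, i.e.
   T_0 (x) ... (x) T_(l-1); see [tensor_map_pure]. *)
Definition tensor_map_fun (t : tensor E) : tensor F :=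
  \sum_(f : tensor_index E)
    t f *: pure_tensor (fun i => T i (tensor_basis (f i))).

Let tensor_map_linear : linear tensor_map_fun.
Proof.
move=> a s t; rewrite /tensor_map_fun scaler_sumr -big_split.
by apply: eq_bigr => f _; rewrite !ffunE scalerDl scalerA.
Qed.

HB.instance Definition _ :=
  GRing.isLinear.Build R _ _ _ tensor_map_fun tensor_map_linear.

Definition tensor_map : 'Hom(tensor E, tensor F) := linfun tensor_map_fun.

Lemma tensor_map_pure (x : forall i, E i) :
  tensor_map (pure_tensor x) = pure_tensor (fun i => T i (x i)).
Proof.
rewrite lfunE /=; apply/ffunP => g; rewrite sum_ffunE.
rewrite [RHS]ffunE.
transitivity (\prod_i \sum_(j < \dim {:E i})
    tensor_coord j (x i) * tensor_coord (g i) (T i (tensor_basis j))).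
  rewrite prod_sum_dffun; apply: eq_bigr => f _.
  by rewrite !ffunE /GRing.scale /= -big_split.
apply: eq_bigr => i _; rewrite [x i in RHS]tensor_coordE linear_sum.
rewrite /tensor_coord linear_sum; apply: eq_bigr => j _.
by rewrite !linearZ.
Qed.

End tensor_map.

End tensor_space.

Section bodies.
Context {R : realType}.

Definition convex_body (E : euclideanType R) (P : set E) :=
  [/\ convex_set P, compact P & P^° !=set0].

Definition symmetric_body (E : euclideanType R) (P : set E) :=
  convex_body P /\ P = [set - x | x in P].

Definition polar (E : euclideanType R) (C : set E) : set E :=
  [set y | (ereal_sup [set (inner x y)%:E | x in C] <= 1)%E].

Definition convex_hull (E : euclideanType R) (A : set E) : set E :=
  smallest (@convex_set R E) A.

Definition isos (E : euclideanType R) (P : set E) : set 'End(E) :=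
  [set w | w @` P = P].

Definition enough_symmetries (E : euclideanType R) (P : set E) :=
  forall T : 'End(E),
    (forall w, isos P w -> (T \o w)%VF = (w \o T)%VF) ->
    exists c : R, T = c *: \1%VF.

Variable l : nat.
Implicit Type E F : 'I_l -> euclideanType R.

Definition proj_tensor E (P : forall i, set (E i)) : set (tensor E) :=
  convex_hull [set pure_tensor x | x in [set x | forall i, P i (x i)]].

Definition inj_tensor E (P : forall i, set (E i)) : set (tensor E) :=
  polar (proj_tensor (fun i => polar (P i))).

(* The values of [alpha] on families that do not consist of 0-symmetric convex
   bodies are irrelevant. *)
Definition tensor_product_of_bodies
    (alpha : forall E, (forall i, set (E i)) -> set (tensor E)) :=
  [/\ forall E (P : forall i, set (E i)),
        (forall i, symmetric_body (P i)) -> symmetric_body (alpha E P),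
      forall E (P : forall i, set (E i)),
        (forall i, symmetric_body (P i)) ->
        proj_tensor P `<=` alpha E P /\ alpha E P `<=` inj_tensor P &
      forall E F (T : forall i, 'Hom(E i, F i))
          (P : forall i, set (E i)) (Q : forall i, set (F i)),
        (forall i, symmetric_body (P i)) -> (forall i, symmetric_body (Q i)) ->
        (forall i, T i @` P i `<=` Q i) ->
        tensor_map T @` alpha E P `<=` alpha F Q].

End bodies.

(* Main.v *)
From HB Require Import structures.
Require Import Defs.
From mathcomp Require Import all_boot all_order all_algebra.
From mathcomp Require Import all_classical all_reals all_analysis.

(** Fix [T] commuting with every isometry of the tensor product body. An
    isometry [w] of [P i] is injective, because it maps [P i], which spans
    [E i], onto itself; hence its inverse is again an isometry of [P i], and the
    mapping property of [alpha], applied to tensor products of isometries and to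
    their inverses, shows that tensor products of isometries of the bodies are
    isometries of [alpha E P] ([tensor_map_isos]). So [T] commutes with
    [1 (x) ... (x) w (x) ... (x) 1] for each slot [i] and each [w] in
    [isos (P i)].

    What is left is linear algebra: if the commutant of a set of operators is
    trivial in each factor, then so is the commutant of all their one-slot
    extensions ([commutant_scalar]). Freeze the input vectors and the output
    coordinates of [T] outside slot [i]. The resulting endomorphism of [E i]
    commutes with the given operators of that slot, hence is a scalar. In terms
    of the matrix of [T] in a basis of pure tensors, each block in which only
    the [i]-th row and column indices vary is a scalar matrix. So an entry
    vanishes as soon as its two multi-indices differ in some slot, and a
    diagonal entry does not change when its multi-index is changed in one slot:
    [T] is diagonal with a constant diagonal. *)

Set Implicit Arguments.
Unset Strict Implicit.
Unset Printing Implicit Defensive.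

Import Order.TTheory GRing.Theory Num.Theory.
Import numFieldNormedType.Exports.

Local Open Scope classical_set_scope.
Local Open Scope ring_scope.

Local Notation dfwith := eqtype.dfwith.
Local Notation dfwith_in := eqtype.dfwith_in.
Local Notation dfwith_out := eqtype.dfwith_out.
Local Notation dfwithP := eqtype.dfwithP.

(** * Isometries of a body with interior points *)

Section isos.
Context {R : realType}.

(** From an interior point, a small step in any direction stays in [P], and
    so in [U]. *)
Lemma full_of_interior (E : euclideanType R) (P : set E) (U : {vspace E}) :
  P^° !=set0 -> (forall x, P x -> x \in U) -> U = fullv.
Proof.
move=> [x0 /nbhs_ballP[r /= r0 rP]] PU.
have x0U : x0 \in U by apply/PU/rP; exact: ballxx.
apply/eqP; rewrite eqEsubv subvf /=; apply/subvP => v _.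
have [->|v0] := eqVneq v 0; first exact: mem0v.
(* [x0 + t *: v] lies at distance [r / 2] from [x0]. *)
pose t := r / 2 / `|v|.
have nv : 0 < `|v| by rewrite normr_gt0.
have t0 : 0 < t by rewrite !divr_gt0.
have : x0 + t *: v \in U.
  apply/PU/rP; rewrite -ball_normE /ball_ /= opprD addNKr normrN normrZ.
  by rewrite gtr0_norm// divfK ?gt_eqF// ltr_pdivrMr// ltr_pMr// ltr1n.
by rewrite rpredDl// rpredZeq (gt_eqF t0).
Qed.

Lemma isos_lker0 (E : euclideanType R) (P : set E) (w : 'End(E)) :
  P^° !=set0 -> isos P w -> lker w == 0%VS.
Proof.
move=> P0 wP.
have wf : limg w = fullv.
  apply: (full_of_interior P0) => x; rewrite -[X in X x]wP => -[y _ <-].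
  exact/memv_img/memvf.
have := limg_ker_dim w fullv.
rewrite wf capfv -{2}[\dim fullv]add0n => /addIn/eqP.
by rewrite dimv_eq0.
Qed.

Lemma isos_inv (E : euclideanType R) (P : set E) (w : 'End(E)) :
  lker w == 0%VS -> isos P w -> isos P w^-1%VF.
Proof.
move=> w0 wP; apply/seteqP; split=> [_ [x Px <-]|x Px].
  by move: Px; rewrite -[X in X x]wP => -[y Py <-]; rewrite lker0_lfunK.
by exists (w x); [rewrite -[X in X _]wP; exists x|rewrite lker0_lfunK].
Qed.

Lemma isos1 (E : euclideanType R) (P : set E) : isos P (\1%VF : 'End(E)).
Proof.
by apply/seteqP; split=> [_ [x Px <-]|x Px]; [|exists x]; rewrite ?id_lfunE.
Qed.

End isos.

(** * Restricting an operator on a tensor product to one slot *)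

Section slots.
Context {R : realType} {l : nat} {E : 'I_l -> euclideanType R}.
Implicit Types (f g : tensor_index E) (x : forall i, E i).

Definition set_index f i (a : 'I_(\dim {:E i})) : tensor_index E :=
  [ffun j => dfwith f a j].

Lemma set_indexK f i : set_index f (f i) = f.
Proof. by apply/ffunP => j; rewrite ffunE; case: dfwithP. Qed.

(** The contraction of [t] with the dual basis vectors of index [f j] in all
    slots [j] other than [i]; see [contract_pure]. *)
Definition contract f i (t : tensor E) : E i :=
  \sum_a t (set_index f a) *: tensor_basis a.

Lemma contract_is_linear f i : linear (contract f i).
Proof.
move=> a s t; rewrite /contract scaler_sumr -big_split.
by apply: eq_bigr => b _; rewrite !ffunE scalerDl scalerA.
Qed.
HB.instance Definition _ f i :=
  GRing.isLinear.Build R _ _ _ (contract f i) (@contract_is_linear f i).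

Lemma contract_pure f i x :
  contract f i (pure_tensor x) =
  (\prod_(j | j != i) tensor_coord (f j) (x j)) *: x i.
Proof.
rewrite [x i in RHS]tensor_coordE scaler_sumr; apply: eq_bigr => a _.
rewrite ffunE (bigD1 i)//= ffunE dfwith_in mulrC scalerA; congr (_ * _ *: _).
by apply: eq_bigr => j ji; rewrite ffunE dfwith_out// eq_sym.
Qed.

Definition insert x i (y : E i) : tensor E := pure_tensor (dfwith x y).

Lemma insert_is_linear x i : linear (@insert x i).
Proof.
move=> a y z; apply/ffunP => f; rewrite !ffunE.
rewrite !(bigD1 (P := predT) i)//= !dfwith_in.
have E0 (u : E i) : \prod_(j < l | j != i) tensor_coord (f j) (dfwith x u j) =
        \prod_(j < l | j != i) tensor_coord (f j) (x j).
  by apply: eq_bigr => j ji; rewrite dfwith_out// eq_sym.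
by rewrite !E0 /tensor_coord linearP mulrDl -[_ *: _ * _]mulrA.
Qed.
HB.instance Definition _ x i :=
  GRing.isLinear.Build R _ _ _ (@insert x i) (@insert_is_linear x i).

(** The operator [1 (x) ... (x) w (x) ... (x) 1]. *)
Definition slot_map i (w : 'End(E i)) : 'End(tensor E) :=
  tensor_map (dfwith (fun j => \1%VF : 'End(E j)) w).

(** With [contract_slot_map], this is why freezing the other slots turns
    commutation with [slot_map w] into commutation with [w]. *)
Lemma slot_map_insert x i (w : 'End(E i)) y :
  slot_map w (insert x y) = insert x (w y).
Proof.
rewrite /slot_map tensor_map_pure; congr pure_tensor.
apply: functional_extensionality_dep => j.
by case: dfwithP => [|k ik]; rewrite ?dfwith_in// !dfwith_out// lfunE.
Qed.

(** Both sides are linear in [t], so pure tensors suffice; on these,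
    [slot_map w] acts on the vector in slot [i] and leaves alone the coordinates
    of the others, which make up the scalar factor. *)
Lemma contract_slot_map f i (w : 'End(E i)) t :
  contract f i (slot_map w t) = w (contract f i t).
Proof.
rewrite [t]tensor_pureE (linear_sum (slot_map w)) !(linear_sum (contract f i)).
rewrite (linear_sum w); apply: eq_bigr => g _.
rewrite !linearZ /=; congr (_ *: _).
rewrite tensor_map_pure !contract_pure linearZ dfwith_in; congr (_ *: _).
by apply: eq_bigr => j ji; rewrite dfwith_out 1?eq_sym// lfunE.
Qed.

Definition basis_tensor f : tensor E :=
  pure_tensor (fun i => tensor_basis (f i)).

Lemma basis_tensorE f g : basis_tensor g f = (f == g)%:R.
Proof. by rewrite ffunE prod_tensor_coord_basis. Qed.

Lemma basis_tensor_set_index g i (b : 'I_(\dim {:E i})) :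
  basis_tensor (set_index g b) =
  insert (fun j => tensor_basis (g j)) (tensor_basis b).
Proof.
congr pure_tensor; apply: functional_extensionality_dep => j.
by rewrite ffunE; case: dfwithP => [|k ik]; rewrite ?dfwith_in ?dfwith_out.
Qed.

Lemma coord_contract f i (a : 'I_(\dim {:E i})) t :
  tensor_coord a (contract f i t) = t (set_index f a).
Proof.
rewrite /contract /tensor_coord linear_sum (bigD1 a)//= big1 => [|b ba].
  rewrite linearZ -/(tensor_coord _ _) /=.
  by rewrite [coord _ _ _]tensor_coord_basis eqxx addr0 [LHS]mulr1.
rewrite linearZ /= [coord _ _ _]tensor_coord_basis eq_sym (negbTE ba).
by rewrite [LHS]mulr0.
Qed.

(** * The commutant of the one-slot operators *)

Section commutant.
Variables (W : forall i, set 'End(E i)) (T : 'End(tensor E)).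
Arguments W : clear implicits.
Hypothesis W_irr : forall i (S : 'End(E i)),
  (forall w, W i w -> (S \o w)%VF = (w \o S)%VF) ->
  exists c : R, S = c *: \1%VF.
Hypothesis TW : forall i w, W i w ->
  (T \o slot_map w)%VF = (slot_map w \o T)%VF.

(** Freezing the inputs and outputs of [T] outside slot [i] yields an
    endomorphism of [E i] that commutes with [W i]. *)
Lemma slot_scalar f x i :
  exists c : R, forall y : E i, contract f i (T (insert x y)) = c *: y.
Proof.
pose S : 'End(E i) := linfun (contract f i \o T \o @insert x i).
have [|c Sc] := W_irr (S := S).
  move=> w Ww; apply/lfunP => y; rewrite !comp_lfunE !lfunE /=.
  rewrite -slot_map_insert -contract_slot_map; congr (contract f i).
  by rewrite -comp_lfunE (TW Ww) comp_lfunE.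
exists c => y; have /lfunP/(_ y) := Sc.
by rewrite scale_lfunE id_lfunE lfunE.
Qed.

(** The matrix form of [slot_scalar]: with the row multi-index [f] and the
    column multi-index [g] fixed outside slot [i], varying them in that slot
    gives a scalar matrix. *)
Lemma slot_coef f g i : exists c : R, forall a b : 'I_(\dim {:E i}),
  T (basis_tensor (set_index g b)) (set_index f a) = c * (a == b)%:R.
Proof.
have [c cE] := slot_scalar f (fun j => tensor_basis (g j)) i.
exists c => a b; rewrite basis_tensor_set_index -coord_contract cE.
by rewrite /tensor_coord linearZ /= [coord _ _ _]tensor_coord_basis.
Qed.

Lemma coef_off_diag f g : f != g -> T (basis_tensor g) f = 0.
Proof.
move=> /tensor_index_neq[i fgi]; have [c cE] := slot_coef f g i.
by have := cE (f i) (g i); rewrite !set_indexK (negbTE fgi) mulr0.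
Qed.

Lemma coef_diag f g : T (basis_tensor f) f = T (basis_tensor g) g.
Proof.
(* [h s] interpolates between [g] and [f]: adding one slot to [s] changes one
   entry of the multi-index, and so stays inside one scalar block. *)
pose h (s : seq 'I_l) : tensor_index E :=
  [ffun i => if i \in s then f i else g i].
have hE s : T (basis_tensor (h s)) (h s) = T (basis_tensor g) g.
  elim: s => [|i s IH].
    by congr (T (basis_tensor _) _); apply/ffunP => j; rewrite ffunE.
  have -> : h (i :: s) = set_index (h s) (f i).
    apply/ffunP => j; rewrite !ffunE inE eq_sym.
    by case: dfwithP => [|k ik]; rewrite ?eqxx ?(negbTE ik) ?ffunE.
  rewrite -{}IH; have [c cE] := slot_coef (h s) (h s) i.
  have := cE (h s i) (h s i); rewrite set_indexK => ->.
  by rewrite cE !eqxx.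
rewrite -(hE (enum 'I_l)); congr (T (basis_tensor _) _);
by apply/ffunP => j; rewrite ffunE mem_enum.
Qed.

Lemma commutant_scalar : exists c : R, T = c *: \1%VF.
Proof.
have Tdiag f : T (basis_tensor f) = T (basis_tensor f) f *: basis_tensor f.
  apply/ffunP => g; rewrite [RHS]ffunE basis_tensorE.
  have [->|gf] := eqVneq g f; first by rewrite [RHS]mulr1.
  by rewrite coef_off_diag// [RHS]mulr0.
have [f0 _|E0] := pickP (tensor_index E).
  exists (T (basis_tensor f0) f0); apply/lfunP => t.
  rewrite scale_lfunE id_lfunE [t]tensor_pureE linear_sum scaler_sumr.
  apply: eq_bigr => f _; rewrite linearZ /= -/(basis_tensor f) Tdiag.
  by rewrite (coef_diag f f0) !scalerA mulrC.
(* Some factor is the zero space, and so is the tensor product. *)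
exists 0; apply/lfunP => t; apply/ffunP => f.
by have := E0 f; rewrite inE.
Qed.

End commutant.
End slots.

(** * Isometries of tensor product bodies *)

(** The mapping property gives only inclusions; applied to [tensor_map w] and to
    the tensor product of the inverses, it gives equality. *)
Lemma tensor_map_isos (R : realType) (l : nat)
    (alpha : forall E : 'I_l -> euclideanType R,
       (forall i, set (E i)) -> set (tensor E))
    (E : 'I_l -> euclideanType R) (P : forall i, set (E i))
    (w : forall i, 'End(E i)) :
  tensor_product_of_bodies alpha -> (forall i, symmetric_body (P i)) ->
  (forall i, isos (P i) (w i)) -> isos (alpha E P) (tensor_map w).
Proof.
move=> alpha_tensor P_body wP; have [_ _ alpha_map] := alpha_tensor.
have w0 i : lker (w i) == 0%VS.
  by have [[_ _ P0] _] := P_body i; exact: isos_lker0 (wP i).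
have map_alpha (v : forall i, 'End(E i)) : (forall i, isos (P i) (v i)) ->
    tensor_map v @` alpha E P `<=` alpha E P.
  by move=> vP; apply: alpha_map => // i; rewrite vP.
apply/seteqP; split=> [|t Pt]; first exact: map_alpha.
pose v i : 'End(E i) := (w i)^-1%VF.
exists (tensor_map v t).
  by apply: (map_alpha v) => [i|]; [exact: isos_inv|exists t].
rewrite [t in RHS]tensor_pureE [t in LHS]tensor_pureE !linear_sum.
apply: eq_bigr => f _; rewrite !linearZ /= !tensor_map_pure.
congr (_ *: pure_tensor _); apply: functional_extensionality_dep => i.
by rewrite -comp_lfunE lker0_compfV// id_lfunE.
Qed.

Theorem proposition3p16 (R : realType) (l : nat)
  (alpha : forall E : 'I_l -> euclideanType R,
     (forall i, set (E i)) -> set (tensor E))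
  (alpha_tensor : tensor_product_of_bodies alpha)
  (E : 'I_l -> euclideanType R) (P : forall i, set (E i))
  (P_body : forall i, symmetric_body (P i))
  (P_symm : forall i, enough_symmetries (P i)) :
  enough_symmetries (alpha E P).
Proof.
move=> T T_comm; apply: (commutant_scalar (W := fun i => isos (P i))) => //.
move=> i w wP; apply: T_comm; apply: tensor_map_isos => // j.
by case: dfwithP => // k _; exact: isos1.
Qed.
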